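(* Let $\mathcal{A}$ denote a finite alphabet. (1) Each infinite follower set $\mathcal{F}_Y(\mathbf{w})\subseteq\mathcal{A}^{\mathbb{N}}$ (of a finite word $\mathbf{w}$ in a two-sided sofic shift $Y\subseteq\mathcal{A}^{\mathbb{Z}}$) coincides with a path set in the same alphabet $\mathcal{A}$. (2) Not all path sets $\mathcal{P}\subseteq\mathcal{A}^{\mathbb{N}}$ are infinite follower sets in the same alphabet $\mathcal{A}$. However, any path set $\mathcal{P}\subseteq\mathcal{A}^{\mathbb{N}}$ is representable as an infinite follower set using an enlarged alphabet $\mathcal{A}':=\mathcal{A}\cup\{a'\}$ containing one extra symbol $a'$.
   Context: A labeled directed graph over an alphabet $\mathcal{A}$ is a finite directed graph $\mathcal{G}$ whose edges carry labels from $\mathcal{A}$; loops and multiple edges are allowed, but the triples (initial vertex, terminal vertex, label) are required to be distinct. A pointed graph $(\mathcal{G},v)$ is such a graph with a distinguished vertex $v$. The path set $X_{\mathcal{G}}(v)\subseteq\mathcal{A}^{\mathbb{N}}$ is the set of all sequences of successive edge labels of one-sided infinite walks in $\mathcal{G}$ starting at $v$; a subset of $\mathcal{A}^{\mathbb{N}}$ is a path set (in the alphabet $\mathcal{A}$) if it equals $X_{\mathcal{G}}(v)$ for some pointed graph $(\mathcal{G},v)$ over $\mathcal{A}$. A two-sided sofic shift $Y\subseteq\mathcal{A}^{\mathbb{Z}}$ is the set of all label sequences of bi-infinite walks in some finite labeled directed graph over $\mathcal{A}$. For a two-sided sofic shift $Y$ and a finite word $\mathbf{w}=\alpha_{-k}\alpha_{-k+1}\cdots\alpha_{-2}\alpha_{-1}$,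 the infinite follower set $\mathcal{F}_Y(\mathbf{w})\subseteq\mathcal{A}^{\mathbb{N}}$ is the set of all possible one-sided infinite sequences $\alpha_0\alpha_1\alpha_2\cdots$ in $Y$ that can directly follow occurrences of the word $\mathbf{w}$ in $Y$. A set is an infinite follower set in (or using) an alphabet $\mathcal{B}$ if it equals $\mathcal{F}_Y(\mathbf{w})$ for some two-sided sofic shift $Y\subseteq\mathcal{B}^{\mathbb{Z}}$ and some finite word $\mathbf{w}$ over $\mathcal{B}$.
   Formalization: The claim that not all path sets are infinite follower sets in the same alphabet is stated for every finite alphabet with at least two letters; with at most one letter it is false, since the only path sets (the empty set and {aaa...}) are infinite follower sets. *)

(* Defs.v *)
From HB Require Import structures.
From mathcomp Require Import all_boot all_order all_algebra.
From mathcomp Require Import boolp classical_sets.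

Set Implicit Arguments.
Unset Strict Implicit.
Unset Printing Implicit Defensive.

Import GRing.Theory.

Local Open Scope classical_set_scope.
Local Open Scope ring_scope.

(* The edges form a set of triples (initial vertex, terminal vertex, label):
   loops and multiple edges are allowed, and the triples are distinct. *)
Record labeled_graph (A : finType) := LabeledGraph {
  vertex : finType;
  edges : {set vertex * vertex * A}
}.
Arguments edges {A} _.

(* As edges are determined by their triples, a walk labeled by x is given by
   the sequence p of vertices it visits. *)
Definition is_walk (A : finType) (G : labeled_graph A)
    (p : nat -> vertex G) (x : nat -> A) : Prop :=
  forall n : nat, (p n, p n.+1, x n) \in edges G.

Definition is_biinfinite_walk (A : finType) (G : labeled_graph A)
    (p : int -> vertex G) (y : int -> A) : Prop :=
  forall i : int, (p i, p (i + 1), y i) \in edges G.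

Definition pointed_path_set (A : finType) (G : labeled_graph A)
    (v : vertex G) : set (nat -> A) :=
  [set x | exists2 p : nat -> vertex G, p 0%N = v & is_walk p x].

Definition path_set (A : finType) (P : set (nat -> A)) : Prop :=
  exists (G : labeled_graph A) (v : vertex G), P = pointed_path_set v.

Definition sofic_shift (A : finType) (Y : set (int -> A)) : Prop :=
  exists G : labeled_graph A,
    Y = [set y | exists p : int -> vertex G, is_biinfinite_walk p y].

(* The word w (possibly empty) occurs in y immediately to the left of
   position i. *)
Definition occurs_before (A : finType) (w : seq A) (y : int -> A) (i : int) :
    Prop :=
  mkseq (fun j : nat => y (i - (size w)%:Z + j%:Z)) (size w) = w.

Definition follower_set (A : finType) (Y : set (int -> A)) (w : seq A) :
    set (nat -> A) :=
  [set x | exists (y : int -> A) (i : int),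
    [/\ Y y, occurs_before w y i & forall n : nat, x n = y (i + n%:Z)]].

Definition infinite_follower_set (A : finType) (P : set (nat -> A)) : Prop :=
  exists (Y : set (int -> A)) (w : seq A),
    sofic_shift Y /\ P = follower_set Y w.

(* The enlarged alphabet is option A, with extra symbol None; a subset of
   the sequences over A is viewed there letterwise through Some. *)
Definition enlarge (A : finType) (P : set (nat -> A)) :
    set (nat -> option A) :=
  [set (fun n => Some (x n)) | x in P].

(* Main.v *)
(* For (1), a right-infinite walk glued to the left half of a bi-infinite walk
   through its initial vertex is again bi-infinite, so [F_Y(w)] is the union of
   the path sets [X_G(v)] over the vertices [v] reached by [w] in some
   bi-infinite walk, and a fresh initial vertex turns a union of path sets into
   a path set.
   For (2), let [a <> b] and let [P] be the set of sequences starting with [a].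
   If [P = F_Y(w)], then [a w b b b ...] may follow [w] in [Y]; hence so may
   [b b b ...], which is not in [P].
   Finally, given [(G, v)], add a vertex [u] with loops labeled by all of [A]
   and an edge labeled [a'] from [u] to [v]: a symbol [a'] then forces the walk
   to be at [v], so the follower set of [a'] is [X_G(v)]. *)
Require Import Defs.
From HB Require Import structures.
From mathcomp Require Import all_boot all_order all_algebra.
From mathcomp Require Import boolp classical_sets.
From mathcomp Require Import zify.

Set Implicit Arguments.
Unset Strict Implicit.
Unset Printing Implicit Defensive.

Import GRing.Theory.

Local Open Scope classical_set_scope.
Local Open Scope ring_scope.

Lemma occurs_beforeP (A : finType) (w : seq A) (y : int -> A) (i : int) (a : A) :
  occurs_before w y i <->
  (forall j, (j < size w)%N -> y (i - (size w)%:Z + j%:Z) = nth a w j).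
Proof.
rewrite /occurs_before; split=> [E j lt_j | E].
  by rewrite -[in RHS]E nth_mkseq.
apply: (@eq_from_nth _ a); rewrite size_mkseq // => j lt_j.
by rewrite nth_mkseq ?E.
Qed.

Lemma occurs_before_ext (A : finType) (w : seq A) (y y' : int -> A) (i : int) :
  (forall n : nat, y' (i - n.+1%:Z) = y (i - n.+1%:Z)) ->
  occurs_before w y i -> occurs_before w y' i.
Proof.
move=> E wy; rewrite /occurs_before -[RHS]wy; apply/eq_in_map => j.
rewrite mem_iota add0n => /andP[_ lt_j].
have -> : i - (size w)%:Z + j%:Z = i - (size w - j).-1.+1%:Z by lia.
exact: E.
Qed.

Lemma glue_walks (A : finType) (G : labeled_graph A) (p : int -> vertex G)
    (y : int -> A) (q : nat -> vertex G) (x : nat -> A) (i : int) :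
  is_biinfinite_walk p y -> is_walk q x -> q 0%N = p i ->
  exists (p' : int -> vertex G) (y' : int -> A),
    [/\ is_biinfinite_walk p' y',
        forall n : nat, y' (i - n.+1%:Z) = y (i - n.+1%:Z) &
        forall n : nat, y' (i + n%:Z) = x n].
Proof.
move=> py qx q0.
(* [Negz n] is [-(n+1)], so the default branch is the part left of [i]. In the edge check below,
   [Negz 0] is the edge crossing the seam, the only place where [q 0 = p i] matters. *)
exists (fun k => if k - i is Posz n then q n else p k).
exists (fun k => if k - i is Posz n then x n else y k); split=> [k|n|n].
- case E: (k - i) => [n|[|n]].
  + have -> : k + 1 - i = n.+1 by lia.
    exact: qx.
  + have Ek : k + 1 = i by lia.
    by rewrite Ek subrr /= q0 -Ek; apply: py.
  + have -> : k + 1 - i = Negz n by lia.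
    exact: py.
- by have -> : i - n.+1%:Z - i = Negz n by lia.
- by have -> : i + n%:Z - i = n by lia.
Qed.

Lemma walk_of_biinfinite (A : finType) (G : labeled_graph A)
    (p : int -> vertex G) (y : int -> A) (i : int) :
  is_biinfinite_walk p y ->
  is_walk (fun n : nat => p (i + n%:Z)) (fun n : nat => y (i + n%:Z)).
Proof.
by move=> py n; rewrite intS [1 + _]addrC addrA; apply: py.
Qed.

(** [None] is the fresh initial vertex: it copies the edges leaving each vertex of [S], and no edge
    enters it. *)
Definition merge_starts (A : finType) (G : labeled_graph A)
    (S : set (vertex G)) : labeled_graph A :=
  @LabeledGraph A (option (vertex G))
    [set e | match e with
             | (Some s, Some t, a) => (s, t, a) \in edges G
             | (None, Some t, a) => [exists s, `[< S s >] && ((s, t, a) \in edges G)]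
             | _ => false
             end]%SET.

Lemma path_set_bigcup (A : finType) (G : labeled_graph A)
    (S : set (vertex G)) :
  path_set (\bigcup_(v in S) pointed_path_set v).
Proof.
exists (merge_starts S), (None : vertex (merge_starts S)).
apply/seteqP; split=> x /=.
  move=> [v Sv [q q0 qx]].
  exists (fun n => if n is 0 then None else Some (q n)) => // -[|n].
    rewrite inE /=; apply/existsP; exists v.
    by rewrite asboolT //= -q0; apply: qx.
  by rewrite inE; apply: qx.
move=> [q q0 qx].
(* Every edge ends in the copy of [G], so the walk is at [None] at time 0 only; there a suitable
   source [s] in [S] replaces it. *)
have q_Some n : exists t, q n.+1 = Some t.
  by have := qx n; rewrite inE; case: (q n) => [s|]; case: (q n.+1) => // t; exists t.
have [r qE] := choice q_Some.
have := qx 0%N; rewrite inE q0 qE => /existsP[s /andP[/asboolP Ss sx]].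
exists s => //; exists (fun n => if n is m.+1 then r m else s) => // -[|n] //.
by have := qx n.+1; rewrite inE !qE.
Qed.

Lemma follower_set_bigcup (A : finType) (G : labeled_graph A) (w : seq A) :
  follower_set [set y | exists p : int -> vertex G, is_biinfinite_walk p y] w =
  \bigcup_(v in [set v | exists (p : int -> vertex G) (y : int -> A) (i : int),
      [/\ is_biinfinite_walk p y, occurs_before w y i & p i = v]])
    pointed_path_set v.
Proof.
apply/seteqP; split=> x.
  move=> [y [i [[p py] wy xE]]]; exists (p i); first by exists p, y, i.
  exists (fun n : nat => p (i + n%:Z)); first by rewrite addr0.
  by move=> n; rewrite xE; apply: walk_of_biinfinite.
move=> [_ [p [y [i [py wy <-]]]] [q q0 qx]].
have [p' [y' [py' yl yr]]] := glue_walks py qx q0.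
exists y', i; split=> [||n]; [by exists p' | exact: occurs_before_ext yl wy |].
by rewrite yr.
Qed.

Lemma path_set_follower_set (A : finType) (Y : set (int -> A)) (w : seq A) :
  sofic_shift Y -> path_set (follower_set Y w).
Proof.
by move=> [G ->]; rewrite follower_set_bigcup; apply: path_set_bigcup.
Qed.

Lemma path_set_cylinder (A : finType) (a : A) :
  path_set [set x : nat -> A | x 0%N = a].
Proof.
(* All edges end at [true]: from [false] only with label [a], from [true] with any label. *)
pose G := @LabeledGraph A bool
  [set e : bool * bool * A | e.1.2 && (e.1.1 || (e.2 == a))]%SET.
exists G, (false : vertex G); apply/seteqP; split=> x /=.
  move=> x0; exists (fun n => n != 0%N) => // -[|n]; rewrite inE //=.
  by rewrite x0.
move=> [p p0 px].
by have := px 0%N; rewrite inE p0 => /andP[_ /eqP].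
Qed.

Lemma cylinder_not_follower_set (A : finType) (a b : A) (Y : set (int -> A))
    (w : seq A) :
  a != b -> [set x : nat -> A | x 0%N = a] <> follower_set Y w.
Proof.
move=> /eqP a_b PE.
(* The default value [b] of [nth] supplies the tail: this is the sequence [a w b b b ...]. *)
have : [set x : nat -> A | x 0%N = a] (nth b (a :: w)) by [].
rewrite PE => -[y [i [Yy _ yE]]].
(* [k] is the position just after [a w], so [w] occurs before it and the tail of [b] starts
   there. *)
apply: a_b; set k := i + (size w).+1%:Z.
have : follower_set Y w (fun n : nat => y (k + n%:Z)).
  exists y, k; split=> //; apply/(occurs_beforeP _ _ _ b) => j lt_j.
  rewrite -[nth b w j]/(nth b (a :: w) j.+1) yE; congr y; lia.
by rewrite -PE /= addr0 -yE /= nth_default.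
Qed.

(** The vertex [None] is the added [u]; the label [None] is the extra symbol. No edge returns to [u]
    from the copy of [G]. *)
Definition prepend_marker (A : finType) (G : labeled_graph A) (v : vertex G) :
    labeled_graph (option A) :=
  @LabeledGraph (option A) (option (vertex G))
    [set e | match e with
             | (Some s, Some t, Some a) => (s, t, a) \in edges G
             | (None, Some t, None) => t == v
             | (None, None, Some _) => true
             | _ => false
             end]%SET.

Lemma enlarge_path_set (A : finType) (G : labeled_graph A) (v : vertex G) :
  enlarge (pointed_path_set v) =
  follower_set [set y | exists p : int -> vertex (prepend_marker v),
                  is_biinfinite_walk p y] [:: None].
Proof.
apply/seteqP; split=> z.
  move=> [x [q q0 qx] <-].
  pose p : int -> vertex (prepend_marker v) := fun=> None.
  (* The left half loops at [u]; any letter would do, and [x 0] is one at hand. The right half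
     starts with the marker edge at position 0, so the follower is read from position 1. *)
  pose y : int -> option A := fun=> Some (x 0%N).
  pose q' n : vertex (prepend_marker v) := if n is m.+1 then Some (q m) else None.
  pose x' n := if n is m.+1 then Some (x m) else None.
  have py : is_biinfinite_walk p y by move=> i; rewrite inE.
  have qx' : is_walk q' x'.
    by move=> [|n]; rewrite inE /= ?q0 //; apply: qx.
  have [p' [y' [py' _ yr]]] := glue_walks (i := 0) py qx' erefl.
  exists y', 1; split; first by exists p'.
    by rewrite /occurs_before /=; congr [:: _]; apply: (yr 0%N).
  by move=> n; rewrite -intS -[n.+1%:Z]add0r yr.
move=> [y [i [[p py] [y_None] zE]]]; rewrite addr0 in y_None.
have p_i : p i = Some v.
  have := py (i - 1); rewrite y_None subrK inE.
  by case: (p _) => [s|]; case: (p i) => [t|] // /eqP->.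
have step k s : p k = Some s -> exists ta, p (k + 1) = Some ta.1 /\ y k = Some ta.2.
  move=> pk; have := py k; rewrite pk inE.
  by case: (p (k + 1)) => [t|]; case: (y k) => [a|] // _; exists (t, a).
(* From [v] on the walk stays in the copy of [G], where the extra symbol labels no edge. *)
have p_Some n : exists s, p (i + n%:Z) = Some s.
  elim: n => [|n [s /step[[t a] [E _]]]]; first by exists v; rewrite addr0.
  by exists t; rewrite intS [1 + _]addrC addrA.
have y_Some n : exists a, y (i + n%:Z) = Some a.
  by have [s /step[[t a] [_ E]]] := p_Some n; exists a.
have [q qE] := choice p_Some; have [x xE] := choice y_Some.
exists x; last by apply/funext => n; rewrite zE xE.
exists q; first by apply: Some_inj; rewrite -qE addr0.
by move=> n; have := walk_of_biinfinite i py n; rewrite !qE xE inE.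
Qed.

Theorem theorem6p1 (A : finType) :
  (forall (Y : set (int -> A)) (w : seq A),
     sofic_shift Y -> path_set (follower_set Y w)) /\
  ((1 < #|A|)%N ->
     exists P : set (nat -> A), path_set P /\ ~ infinite_follower_set P) /\
  (forall P : set (nat -> A),
     path_set P -> infinite_follower_set (enlarge P)).
Proof.
split; first exact: path_set_follower_set.
split=> [/card_gt1P[a [b [_ _ a_b]]] | _ [G [v ->]]].
  exists [set x : nat -> A | x 0%N = a]; split; first exact: path_set_cylinder.
  by move=> [Y [w [_ /(cylinder_not_follower_set a_b)]]].
exists [set y | exists p : int -> vertex (prepend_marker v), is_biinfinite_walk p y].
exists [:: None]; split; last exact: enlarge_path_set.
by exists (prepend_marker v).
Qed.
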